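(* Let $G=(U\cup W,E)$ be a non-trivial circular graph. Then: (i) $d(u_1,u_2)=2$ for any distinct $u_1,u_2\in U$; (ii) $d(w_1,w_2)=2$ or $d(w_1,w_2)=4$ for any distinct $w_1,w_2\in W$; (iii) $d(u_1,w_1)\in\{1,3\}$ for any $u_1\in U$ and $w_1\in W$. Here $d(\cdot,\cdot)$ denotes the distance in $G$.
   Context: All graphs are finite and simple. For vertices $v_1,\dots,v_k$, $cn(v_1,\dots,v_k)$ denotes the number of common neighbours of $v_1,\dots,v_k$. A circular graph is a finite bipartite graph $G$ with a specified bipartition $V(G)=U\cup W$ into nonempty sets ($U\cap W=\emptyset$, every edge joins $U$ to $W$) such that (i) $cn(u_i,u_j,u_k)=1$ for all distinct $u_i,u_j,u_k\in U$, and (ii) $d(w)\ge 3$ for every $w\in W$. It is trivial if $|U|=1$ or $|W|=1$, and non-trivial otherwise. *)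

(* Defs.v *)
From mathcomp Require Import all_boot.

Set Implicit Arguments.
Unset Strict Implicit.
Unset Printing Implicit Defensive.

Section Graphs.

Variables (T : finType) (e : rel T).

(* A finite simple graph is given by its adjacency relation [e] on [T]. *)
Definition simple_graph : Prop := symmetric e /\ irreflexive e.

Definition deg (v : T) : nat := #|[set x | e v x]|.

Definition cn (vs : seq T) : nat := #|[set x | all (fun v => e v x) vs]|.

(* [p] has [n] entries and excludes the starting vertex [x], so it encodes a
   walk from [x] to [y] with exactly [n] edges. *)
Definition walk (x y : T) (n : nat) : bool :=
  [exists p : n.-tuple T, path e x p && (last x p == y)].

Lemma walkP x y n :
  reflect (exists p : seq T, [/\ size p = n, path e x p & last x p = y])
          (walk x y n).
Proof.
apply: (iffP existsP) => [[p /andP[ep /eqP ly]] | [p [sp ep ly]]].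
  by exists p; rewrite size_tuple.
by exists (Tuple (introT eqP sp)); rewrite /= ep ly eqxx.
Qed.

Lemma connect_walk x y : connect e x y -> exists n, walk x y n.
Proof. by case/connectP=> p ep ->; exists (size p); apply/walkP; exists p. Qed.

(* [None] stands for infinite distance: [x] and [y] are in different connected
   components. *)
Definition dist (x y : T) : option nat :=
  match @idP (connect e x y) with
  | ReflectT cxy => Some (ex_minn (connect_walk cxy))
  | ReflectF _ => None
  end.

Lemma distP x y n :
  dist x y = Some n <-> walk x y n /\ (forall m, walk x y m -> n <= m).
Proof.
rewrite /dist; case: {-}_ / idP => [cxy | ncxy].
  case: ex_minnP => m wm min_m; split=> [[<-] // | [wn min_n]].
  by congr Some; apply/eqP; rewrite eqn_leq min_m // min_n.
split=> // -[/walkP[p [_ ep ly]] _]; case: ncxy.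
by apply/connectP; exists p.
Qed.

Definition bipartition (U W : {set T}) : Prop :=
  [/\ U != set0, W != set0, U :&: W = set0, U :|: W = [set: T]
    & forall x y, e x y -> (x \in U) && (y \in W) || (x \in W) && (y \in U)].

Definition circular_graph (U W : {set T}) : Prop :=
  [/\ simple_graph, bipartition U W,
      forall u1 u2 u3, u1 \in U -> u2 \in U -> u3 \in U ->
        u1 != u2 -> u1 != u3 -> u2 != u3 -> cn [:: u1; u2; u3] = 1
    & forall w, w \in W -> 3 <= deg w].

End Graphs.

Definition trivial_bipartition (T : finType) (U W : {set T}) : Prop :=
  #|U| = 1 \/ #|W| = 1.

(* Main.v *)
Require Import Defs.
From mathcomp Require Import all_boot.

Set Implicit Arguments.
Unset Strict Implicit.
Unset Printing Implicit Defensive.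

(** Every [w] in [W] has three neighbours, all in [U], so [U] has at least three
    elements, and completing two of them to a triple yields a common neighbour.
    This gives walks of length 2 inside [U], hence of length at most 3 from [U]
    to [W] and at most 4 inside [W]; a shorter walk has the same parity, since
    every edge switches sides. *)

Section Walks.

Variables (T : finType) (e : rel T).

Lemma walk0 x y : walk e x y 0 = (x == y).
Proof.
apply/walkP/eqP => [[p [/size0nil -> _ <-]] // | <-].
by exists [::].
Qed.

Lemma walkS x y n : walk e x y n.+1 = [exists z, e x z && walk e z y n].
Proof.
apply/walkP/existsP => [[[|z p] [] // [sp] /= /andP[exz ep] ly] | [z]].
  by exists z; rewrite exz; apply/walkP; exists p.
case/andP=> exz /walkP[p [sp ep ly]].
by exists (z :: p); rewrite /= sp exz.
Qed.

Lemma walk1 x y : walk e x y 1 = e x y.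
Proof.
rewrite walkS; apply/existsP/idP => [[z] | exy].
  by rewrite walk0 => /andP[exz /eqP <-].
by exists y; rewrite walk0 exy eqxx.
Qed.

Lemma walk_cons x z y n : e x z -> walk e z y n -> walk e x y n.+1.
Proof. by move=> exz wzy; rewrite walkS; apply/existsP; exists z; rewrite exz. Qed.

End Walks.

Section CircularGraph.

Variables (T : finType) (e : rel T) (U W : {set T}).
Hypothesis circG : circular_graph e U W.

Lemma mem_W_notin_U x : (x \in W) = (x \notin U).
Proof.
have [_ [_ _ UW0 UWT _] _ _] := circG.
have /setP/(_ x) := UW0; have /setP/(_ x) := UWT.
by rewrite !inE; case: (x \in U); case: (x \in W).
Qed.

Lemma edge_sides x y : e x y -> (y \in U) = (x \notin U).
Proof.
have [_ [_ _ _ _ eUW] _ _] := circG.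
by move/eUW; rewrite !mem_W_notin_U; case: (x \in U); case: (y \in U).
Qed.

Lemma walk_parity x y n : walk e x y n -> odd n = ((x \in U) != (y \in U)).
Proof.
elim: n x => [|n IHn] x; first by rewrite walk0 => /eqP ->; rewrite eqxx.
rewrite walkS => /existsP[z /andP[/edge_sides exz /IHn /= ->]].
by rewrite exz; case: (x \in U); case: (y \in U).
Qed.

(** At least three neighbours cannot all fit into [[set u1; u2]]. Taking [u1 = u2] is allowed and
    amounts to avoiding a single vertex. *)
Lemma exists_neighbour_avoiding w u1 u2 :
  w \in W -> exists u, [/\ u \in U, e w u, u != u1 & u != u2].
Proof.
have [_ _ _ deg3] := circG; move=> Ww.
have /subsetPn[u] : ~~ ([set x | e w x] \subset [set u1; u2]).
  apply/negP=> /subset_leq_card; apply/negP; rewrite -ltnNge cards2.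
  by apply: leq_trans (deg3 w Ww); case: (u1 != u2).
rewrite !inE negb_or => ewu /andP[uu1 uu2].
by exists u; rewrite (edge_sides ewu) -mem_W_notin_U.
Qed.

Lemma common_neighbour u1 u2 :
  u1 \in U -> u2 \in U -> u1 != u2 -> exists w, e u1 w && e u2 w.
Proof.
have [_ [_ /set0Pn[w Ww] _ _ _] cn1 _] := circG.
move=> Uu1 Uu2 u12.
(* An arbitrary [w] in the nonempty set [W] supplies the third vertex of the triple; its adjacency
   to [w] is then forgotten. *)
have [u3 [Uu3 _ u31 u32]] := exists_neighbour_avoiding u1 u2 Ww.
have cn_eq1 : cn e [:: u1; u2; u3] = 1 by apply: cn1 => //; rewrite eq_sym.
have /card_gt0P[x] : 0 < cn e [:: u1; u2; u3] by rewrite cn_eq1.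
by rewrite inE /= => /and3P[eu1x eu2x _]; exists x; rewrite eu1x.
Qed.

Lemma walk2_U u1 u2 : u1 \in U -> u2 \in U -> u1 != u2 -> walk e u1 u2 2.
Proof.
have [[e_sym _] _ _ _] := circG.
move=> Uu1 Uu2 /(common_neighbour Uu1 Uu2)[w /andP[eu1w eu2w]].
by apply: walk_cons eu1w _; rewrite walk1 e_sym.
Qed.

(** The walk is [u], [x], [u'], [w], where [u'] is a neighbour of [w] other than [u] and [x] is a
    common neighbour of [u] and [u']. It exists even if [u] and [w] are adjacent. *)
Lemma walk3_UW u w : u \in U -> w \in W -> walk e u w 3.
Proof.
have [[e_sym _] _ _ _] := circG.
move=> Uu Ww; have [u' [Uu' ewu' u'u _]] := exists_neighbour_avoiding u u Ww.
have [x /andP[eux eu'x]] : exists x, e u x && e u' x.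
  by apply: common_neighbour => //; rewrite eq_sym.
apply: walk_cons eux _; apply: (@walk_cons _ _ _ u'); first by rewrite e_sym.
by rewrite walk1 e_sym.
Qed.

Lemma walk4_W w1 w2 : w1 \in W -> w2 \in W -> walk e w1 w2 4.
Proof.
(* Any neighbour of [w1] serves, so [w1] itself is a dummy vertex to avoid. *)
move=> Ww1 Ww2; have [u [Uu ew1u _ _]] := exists_neighbour_avoiding w1 w1 Ww1.
exact: walk_cons ew1u (walk3_UW Uu Ww2).
Qed.

(** Length 0 would force [x = y], and length 1 has the wrong parity. Stated by side so that it
    covers both [U] and [W]. *)
Lemma dist_same_side2 x y :
  (x \in U) = (y \in U) -> x != y -> walk e x y 2 -> dist e x y = Some 2.
Proof.
move=> xyU xy w2; apply/distP; split=> // -[|[|m]] // wm.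
  by move: wm; rewrite walk0 (negbTE xy).
by have := walk_parity wm; rewrite xyU eqxx.
Qed.

End CircularGraph.

Theorem theorem2p6 (T : finType) (e : rel T) (U W : {set T})
    (circG : circular_graph e U W) (nontrivG : ~ trivial_bipartition U W) :
  [/\ forall u1 u2, u1 \in U -> u2 \in U -> u1 != u2 ->
        dist e u1 u2 = Some 2,
      forall w1 w2, w1 \in W -> w2 \in W -> w1 != w2 ->
        dist e w1 w2 = Some 2 \/ dist e w1 w2 = Some 4
    & forall u1 w1, u1 \in U -> w1 \in W ->
        dist e u1 w1 = Some 1 \/ dist e u1 w1 = Some 3].
Proof.
have WE := mem_W_notin_U circG.
split=> [u1 u2 Uu1 Uu2 u12 | w1 w2 Ww1 Ww2 w12 | u w Uu Ww].
- by apply: (dist_same_side2 circG); rewrite ?Uu1 ?Uu2 //; exact: (walk2_U circG).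
- have sides : (w1 \in U) = (w2 \in U).
    by move: Ww1 Ww2; rewrite !WE => /negbTE -> /negbTE ->.
  case: (boolP (walk e w1 w2 2)) => [walk2 | nwalk2].
    by left; apply: (dist_same_side2 circG).
  right; apply/distP; split=> [|m wm]; first exact: (walk4_W circG).
  have := walk_parity circG wm; rewrite sides eqxx.
  (* Parity rules out lengths 1 and 3, and [nwalk2] rules out 2; length 0 remains and contradicts
     [w1 != w2]. *)
  case: m wm => [|[|[|[|m]]]] // wm _; last by rewrite wm in nwalk2.
  by move: wm; rewrite walk0 (negbTE w12).
- have odd_walk m : walk e u w m -> odd m.
    by move/(walk_parity circG) ->; move: Ww; rewrite WE Uu => /negbTE ->.
  case: (boolP (e u w)) => [euw | neuw]; [left | right]; apply/distP.
    by split=> [|[|m] // /odd_walk]; rewrite ?walk1.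
  split=> [|m wm]; first exact: (walk3_UW circG).
  have := odd_walk m wm.
  (* The only odd length below 3 is 1, which would be an edge. *)
  by case: m wm => [|[|[|m]]] // wm _; rewrite walk1 (negbTE neuw) in wm.
Qed.
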